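(* Let $L\subset\mathbb{R}^n$ be compact with $L\subseteq B_R^n$ for a finite radius $R>0$. Then strong duality holds between the following two programs, i.e. $p^*=m^*$. (Function program) $p^*$ is the infimum of $\gamma$ over all $\gamma\in\mathbb{R}$ and $w\in C(\Psi)$ satisfying $\gamma\ge\Lambda_R w(\theta,t,Z)$ for all $(\theta,t,Z)\in\Omega_Z$, $w\ge1$ on $\Psi_L$, and $w\ge0$ on $\Psi$. (Measure program) $m^*$ is the supremum of $\mu(\Psi_L)$ over all triples $\mu_0\in\mathcal{M}_+(\Omega_Z)$, $\mu\in\mathcal{M}_+(\Psi_L)$, $\hat\mu\in\mathcal{M}_+(\Psi)$ satisfying $\mu_0\otimes\lambda_R^{n-1}=\mu+\hat\mu$ (as measures on $\Psi$) and $\mu_0(\Omega_Z)=1$.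
   Context: $n$ is a positive integer, $B_R^m=\{y\in\mathbb{R}^m:\|y\|_2\le R\}$, $S^{n-1}$ is the unit sphere of $\mathbb{R}^n$, $O(n)$ is the orthogonal group, $C(X)$ is the set of real continuous functions on $X$, and $\mathcal{M}_+(X)$ is the set of nonnegative Borel measures on $X$ (measures on a subset are regarded as measures on the larger set by extension by zero). $\lambda_R^{n-1}$ is the Lebesgue measure on the ball $B_R^{n-1}$. Define $\Omega_Z=\{(\theta,t,Z)\in S^{n-1}\times[-R,R]\times\mathbb{R}^{n\times(n-1)}:\ [\theta,Z]\in O(n)\}$, $\Psi=\Omega_Z\times B_R^{n-1}$ (points written $(\theta,t,Z,y)$), $\Psi_L=\{(\theta,t,Z,y)\in\Psi:\ \theta t+Zy\in L\}$, and $\Lambda_R w(\theta,t,Z)=\int_{B_R^{n-1}}w(\theta,t,Z,y)\,dy$. *)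

(* Defs.v *)
From HB Require Import structures.
From mathcomp Require Import all_boot all_order all_algebra.
From mathcomp Require Import all_classical all_reals all_analysis.

Set Implicit Arguments.
Unset Strict Implicit.
Unset Printing Implicit Defensive.

Import Order.TTheory GRing.Theory Num.Theory.
Import numFieldNormedType.Exports.

Local Open Scope classical_set_scope.
Local Open Scope ring_scope.

(* Throughout, m.+1 is the dimension n >= 1 of the ambient space, so that m is
   n - 1. Vectors are columns. *)

(* Missing join: products of pointed topological spaces are pointed. *)
HB.instance Definition _ (T U : ptopologicalType) := Pointed.on (T * U)%type.

Definition borel (T : ptopologicalType) := g_sigma_algebraType (@open T).

(* Nonnegative Borel measures on X, extended by zero to the ambient space T;
   meant for Borel sets X only (here: closed ones). *)
Definition borel_measures_on (R : realType) (T : ptopologicalType)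
    (X : set T) : set {measure set (borel T) -> \bar R} :=
  [set mu | mu (~` X) = 0%E].

(* The norm `|x| of the library on matrices is the sup norm. *)
Definition l2norm (R : realType) (k : nat) (x : 'cV[R]_k) : R :=
  Num.sqrt (\sum_(i < k) x i 0 ^+ 2).

Definition l2ball (R : realType) (k : nat) (r : R) : set 'cV[R]_k :=
  [set x | l2norm x <= r].

Definition l2sphere (R : realType) (k : nat) : set 'cV[R]_k :=
  [set x | l2norm x = 1].

Definition orthogonal_group (R : realType) (k : nat) : set 'M[R]_k :=
  [set A | A^T *m A = 1%:M].

(* Lebesgue measure on R^k as the iterated product of the one-dimensional one;
   on R^0 = {0} it is the unit mass. *)
Fixpoint lebesgue_cV (R : realType) (k : nat) :
    set (borel 'cV[R]_k) -> \bar R :=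
  match k with
  | 0 => @dirac _ (borel 'cV[R]_0) (0 : 'cV[R]_0) R
  | k'.+1 =>
      pushforward (lebesgue_measure \x @lebesgue_cV R k')%E
        (fun p : measurableTypeR R * borel 'cV[R]_k' =>
           col_mx (p.1)%:M p.2 : borel 'cV[R]_(1 + k'))
  end.

Definition lebesgue_ball (R : realType) (k : nat) (r : R) :
    set (borel 'cV[R]_k) -> \bar R :=
  fun A => lebesgue_cV (A `&` l2ball r).

Section programs.
Context (R : realType) (m : nat).

(* Points (theta, t, Z), resp. ((theta, t, Z), y). *)
Definition omegaT := ('cV[R]_m.+1 * R * 'M[R]_(m.+1, m))%type.
Definition psiT := (omegaT * 'cV[R]_m)%type.

(* row_mx theta Z has type 'M_(m.+1, 1 + m), and 1 + m is convertible to
   m.+1. *)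
Definition Omega_Z (r : R) : set omegaT :=
  [set p | let: (theta, t, Z) := p in
    [/\ l2sphere theta, - r <= t <= r
      & @orthogonal_group R m.+1 (row_mx theta Z)]].

Definition Psi (r : R) : set psiT := Omega_Z r `*` l2ball r.

Definition Psi_L (r : R) (L : set 'cV[R]_m.+1) : set psiT :=
  Psi r `&`
  [set q | let: ((theta, t, Z), y) := q in L (t *: theta + Z *m y)].

Definition Lambda (r : R) (w : psiT -> R) (p : omegaT) : \bar R :=
  (\int[@lebesgue_cV R m]_(y in l2ball r) (w (p, y))%:E)%E.

Definition function_feasible (r : R) (L : set 'cV[R]_m.+1)
    (gamma : R) (w : psiT -> R) : Prop :=
  [/\ {within Psi r, continuous w},
      forall p, Omega_Z r p -> (Lambda r w p <= gamma%:E)%E,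
      forall q, Psi_L r L q -> 1 <= w q
    & forall q, Psi r q -> 0 <= w q].

Definition p_star (r : R) (L : set 'cV[R]_m.+1) : \bar R :=
  ereal_inf [set gamma%:E | gamma in
    [set gamma | exists w, function_feasible r L gamma w]].

Definition measure_feasible (r : R) (L : set 'cV[R]_m.+1)
    (mu0 : {measure set (borel omegaT) -> \bar R})
    (mu muhat : {measure set (borel psiT) -> \bar R}) : Prop :=
  [/\ borel_measures_on (Omega_Z r) mu0,
      borel_measures_on (Psi_L r L) mu,
      borel_measures_on (Psi r) muhat,
      forall A : set (borel psiT), measurable A ->
        (mu0 \x @lebesgue_ball R m r)%E (A : set (borel omegaT * borel 'cV[R]_m)) = (mu A + muhat A)%E
    & mu0 (Omega_Z r) = 1%E].

Definition m_star (r : R) (L : set 'cV[R]_m.+1) : \bar R :=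
  ereal_sup [set v | exists mu0 mu muhat,
    measure_feasible r L mu0 mu muhat /\ v = mu (Psi_L r L)].

End programs.

(* Main.v *)
Require Import Defs.
From HB Require Import structures.
From mathcomp Require Import all_boot all_order all_algebra.
From mathcomp Require Import all_classical all_reals all_analysis.
From mathcomp Require Import measurable_realfun lra.
Import Order.TTheory GRing.Theory Num.Theory.
Import numFieldNormedType.Exports.
Local Open Scope classical_set_scope.
Local Open Scope ring_scope.
Set Implicit Arguments.
Unset Strict Implicit.
Unset Printing Implicit Defensive.

(* Both values equal the supremum over p in Omega_Z of f(p), the Lebesgue
   measure of the section {y in B_R | (p, y) in Psi_L}. Weak duality
   m* <= p* follows by integrating w against mu0 \x lambda_R with Tonelli's
   theorem. A Dirac mass mu0 at p, split along Psi_L, gives f(p) <= m*.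
   Conversely, take u continuous with values in ]0, 1] and u = 1 exactly on L;
   the functions w_k(p, y) = u(theta t + Z y)^k are admissible up to gamma, and
   Lambda w_k decreases pointwise to f. Each Lambda w_k is upper semicontinuous
   and Omega_Z is compact, so any c > sup f bounds Lambda w_k on Omega_Z for
   some k, as in Dini's theorem, whence p* <= c. *)

(** * Borel sigma-algebras, their products, and sigma-finite measures *)

Lemma mx_second_countable (R : realType) (m n : nat) :
  @second_countable 'M[R]_(m, n).
Proof.
pose B (p : 'M[rat]_(m, n) * rat) : set 'M[R]_(m, n) :=
  ball (map_mx ratr p.1 : 'M[R]_(m, n)) (ratr p.2 : R).
exists (range B).
  exact: card_le_trans (card_image_le _ _) (countableP _).
split=> [_ [p _ <-]|x A /nbhs_ballP[e /= e0 eA]]; first exact: ball_open.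
(* A rational center is chosen entrywise within e/4 of [x]. A radius above e/4 then puts [x] in the
   ball, and one below e/2 keeps the ball inside [ball x e], as e/4 + e/2 < e. *)
have [q /andP[q1 q2]] : exists q : rat, e / 4 < ratr q < e / 2.
  have [|q] := @rat_in_itvoo R (e / 4) (e / 2); first lra.
  by rewrite in_itv/= => ?; exists q.
have cP i j : exists c : rat, `|x i j - ratr c| < e / 4.
  have [|c] := @rat_in_itvoo R (x i j - e / 4) (x i j + e / 4); first lra.
  by rewrite in_itv/= => ?; exists c; rewrite ltr_distl; lra.
pose c : 'M[rat]_(m, n) := \matrix_(i, j) projT1 (cid (cP i j)).
have xc i j : `|x i j - map_mx ratr c i j| < e / 4.
  by rewrite !mxE; case: cid.
exists (B (c, q)).
  split; first by exists (c, q).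
  split=> [|i j]; rewrite /B/= ?/ball/=; first lra.
  by rewrite distrC; apply: lt_trans (xc i j) _.
move=> y [/= _ yB]; apply: eA; split=> [//|i j].
have := yB i j; have := xc i j; rewrite /ball/= => h1 h2.
rewrite (le_lt_trans (ler_distD (map_mx ratr c i j) _ _))//; lra.
Qed.

Lemma closed_borel (T : ptopologicalType) (A : set T) :
  closed A -> measurable (A : set (borel T)).
Proof.
move=> cA; rewrite -(setCK A); apply: measurableC.
by apply: sub_sigma_algebra; exact: closed_openC.
Qed.

(* The sections over the members V of a countable basis of the second factor
   exhibit an open set as a countable union of rectangles. *)
Lemma open_measurable_prod d (X : measurableType d) (T U : ptopologicalType)
    (f : X -> T) (A : set (T * U)) :
  (forall V, open V -> measurable (f @^-1` V)) ->
  @second_countable U -> open A ->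
  measurable ([set p | A (f p.1, p.2)] : set (X * borel U)).
Proof.
move=> mf [B cB [Bo Bb]] oA.
pose S V : set T := [set x | \forall x' \near x, V `<=` [set y | A (x', y)]].
have oS V : open (S V).
  by rewrite openE => x; exact: nbhs_interior.
rewrite (_ : [set p | _] = \bigcup_(V in B) ((f @^-1` S V) `*` V)).
  rewrite bigcup_set_type.
  apply: countable_bigcupT_measurable => //.
    by rewrite (eq_countable (card_setT _)).
  move=> V; apply: measurableX; first exact/mf/oS.
  by apply: sub_sigma_algebra; apply: Bo; exact: set_valP.
apply/seteqP; split=> [[x y] /= Axy|[x y] [V BV [/= Sx Vy]]];
  last exact: nbhs_singleton Sx _ Vy.
have [[P Q] [/= Px Qy] PQ] : nbhs (f x, y) A by exact: open_nbhs_nbhs.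
have [V [BV Vy] VQ] := Bb y Q Qy.
exists V => //; split=> //=.
by apply: filterS Px => x' Px' y' /VQ Qy'; exact: (PQ (x', y')).
Qed.

(** The measure program evaluates a product measure on Borel sets of [psiT], so these must belong to
    the product sigma-algebra. It suffices to check open sets, which generate the Borel one. *)
Lemma borel_measurable_prod (T U : ptopologicalType) :
  @second_countable U ->
  forall A : set (T * U), measurable (A : set (borel (T * U)%type)) ->
  measurable (A : set (borel T * borel U)).
Proof.
move=> scU; apply: smallest_sub.
  exact: (@sigma_algebra_measurable _ (borel T * borel U)%type).
move=> A oA; have := @open_measurable_prod _ (borel T) T U id A _ scU oA.
rewrite [X in measurable X](_ : _ = A)//; last by apply/seteqP; split=> -[].
by apply=> V oV; exact: sub_sigma_algebra.
Qed.

Lemma continuous_borel (T U : ptopologicalType) (f : T -> U) :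
  continuous f -> measurable_fun setT (f : borel T -> borel U).
Proof.
move=> /continuousP cf; apply: measurability; first by [].
by move=> _ [V oV <-]; rewrite setTI; apply: sub_sigma_algebra; exact: cf.
Qed.

Lemma continuous_borel_real (R : realType) (T : ptopologicalType) (f : T -> R) :
  continuous f -> measurable_fun setT (f : borel T -> R).
Proof.
move=> /continuousP cf; apply: (measurability _ (RGenOpens.measurableE R)).
move=> _ [_ [a [b ->]] <-]; rewrite setTI; apply: sub_sigma_algebra.
by apply: cf; exact: interval_open.
Qed.

(* The unused proof argument makes the sigma-finiteness instance inferable. *)
Definition sigma_finite_of d (T : measurableType d) (R : realType)
    (mu : {measure set T -> \bar R}) (_ : sigma_finite setT mu) :
  set T -> \bar R := mu.

HB.instance Definition _ d (T : measurableType d) (R : realType)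
    (mu : {measure set T -> \bar R}) (sf : sigma_finite setT mu) :=
  Measure.on (sigma_finite_of sf).

HB.instance Definition _ d (T : measurableType d) (R : realType)
    (mu : {measure set T -> \bar R}) (sf : sigma_finite setT mu) :=
  Measure_isSigmaFinite.Build _ _ _ (sigma_finite_of sf) sf.

(** Lets a proved sigma-finiteness be used where a bundled sigma-finite measure is required, as in
    products and Tonelli's theorem. *)
Lemma sigma_finite_measureP d (T : measurableType d) (R : realType)
    (mu : {measure set T -> \bar R}) :
  sigma_finite setT mu ->
  exists nu : {sigma_finite_measure set T -> \bar R},
    (nu : set T -> \bar R) = mu.
Proof. by move=> sf; exists (sigma_finite_of sf). Qed.

(** * Lebesgue measure on column vectors *)

Lemma continuous_mx (R : realType) (T : topologicalType) (m n : nat)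
    (f : T -> 'M[R]_(m, n)) :
  (forall i j, continuous (fun x => f x i j)) -> continuous f.
Proof.
move=> cf x A [P Px PA].
have : \forall y \near x, forall ij : 'I_m * 'I_n, P ij.1 ij.2 (f y ij.1 ij.2).
  by apply: filter_forall => ij; exact: (cf _ _ x _ (Px _ _)).
by apply: filterS => y Py; apply: PA => i j; exact: (Py (i, j)).
Qed.

Lemma le_mx_norm (R : realType) (m n : nat) (x : 'M[R]_(m, n)) i j :
  `|x i j| <= `|x|.
Proof.
rewrite {2}/Num.norm/= mx_normrE.
exact: (le_bigmax _ (fun ij : 'I_m * 'I_n => `|x ij.1 ij.2|) (i, j)).
Qed.

Lemma mx_norm_le (R : realType) (m n : nat) (x : 'M[R]_(m, n)) (c : R) :
  0 <= c -> (forall i j, `|x i j| <= c) -> `|x| <= c.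
Proof.
by move=> c0 xc; rewrite {1}/Num.norm/= mx_normrE; apply: bigmax_le.
Qed.

Lemma closed_normle (R : realType) (V : normedModType R) (c : R) :
  closed [set x : V | `|x| <= c].
Proof.
exact: (iffLR (continuous_closedP _) (@norm_continuous _ V) _ (@closed_le _ c)).
Qed.

Lemma continuous_col_mx (R : realType) (k : nat) :
  continuous (fun p : R * 'cV[R]_k => col_mx p.1%:M p.2 : 'cV[R]_(1 + k)).
Proof.
apply: continuous_mx => i j.
rewrite [X in continuous X](_ : _ = fun x : R * 'cV[R]_k =>
  match fintype.split i with inl _ => x.1 | inr i' => x.2 i' j end).
  move=> p.
  case: fintype.split => [_|i']; first exact: cvg_fst.
  apply: (@continuous_comp _ _ _ snd (fun M : 'cV[R]_k => M i' j)).
    exact: cvg_snd.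
  exact: coord_continuous.
apply/funext => x; rewrite mxE; case: fintype.split => // i'.
by rewrite !ord1 mxE eqxx.
Qed.

(** The source carries the product sigma-algebra, not the Borel one, so open preimages obtained from
    continuity go through [open_measurable_prod]. *)
Lemma measurable_col_mx (R : realType) (k : nat) :
  measurable_fun setT (fun p : measurableTypeR R * borel 'cV[R]_k =>
    col_mx (p.1)%:M p.2 : borel 'cV[R]_(1 + k)).
Proof.
apply: measurability; first by [].
move=> _ [V oV <-]; rewrite setTI.
have /continuousP/(_ V oV) := @continuous_col_mx R k.
have mid (W : set R) : open W ->
    measurable ((id : measurableTypeR R -> R) @^-1` W).
  exact: open_measurable.
move=> /(open_measurable_prod mid (@mx_second_countable R k 1)).
by [].
Qed.

Lemma sigma_finite_mx (R : realType) (m n : nat)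
    (mu : {measure set (borel 'M[R]_(m, n)) -> \bar R}) :
  (forall c : R, (mu [set x : 'M[R]_(m, n) | (`|x| <= c)%R] < +oo)%E) ->
  sigma_finite setT mu.
Proof.
move=> muoo; exists (fun i => [set x : 'M[R]_(m, n) | `|x| <= i%:R]).
  apply/esym/seteqP; split=> // x _; exists (Num.truncn `|x|).+1 => //=.
  by rewrite ltW// truncnS_gt.
by move=> i; split=> //; apply: closed_borel; exact: closed_normle.
Qed.

(** [lebesgue_cV] is a bare recursive set function; this identifies it with a bundled measure. The
    induction carries finiteness on sup-norm balls: it yields the sigma-finiteness needed to form
    the next product, and it is inherited because the preimage of a ball under [col_mx] lies in an
    interval times a ball. *)
Lemma lebesgue_cV_sigma_finite (R : realType) (k : nat) :
  exists mu : {sigma_finite_measure set (borel 'cV[R]_k) -> \bar R},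
    @lebesgue_cV R k = mu /\
    forall c : R, (mu [set x : 'cV[R]_k | (`|x| <= c)%R] < +oo)%E.
Proof.
suff [mu [muE muoo]] : exists mu : {measure set (borel 'cV[R]_k) -> \bar R},
    @lebesgue_cV R k = mu /\
    forall c : R, (mu [set x : 'cV[R]_k | (`|x| <= c)%R] < +oo)%E.
  have [nu nuE] := sigma_finite_measureP (sigma_finite_mx muoo).
  by exists nu; rewrite nuE.
elim: k => [|k [mu [muE muoo]]].
  exists (@dirac _ (borel 'cV[R]_0) (0 : 'cV[R]_0) R); split=> // c.
  by rewrite /dirac ltry.
have [nu nuE] := sigma_finite_measureP (sigma_finite_mx muoo).
pose lam := @lebesgue_measure R.
pose pm : {measure set _ -> \bar R} := (lam \x nu)%E.
pose f := fun p : measurableTypeR R * borel 'cV[R]_k =>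
    col_mx (p.1)%:M p.2 : borel 'cV[R]_(1 + k).
have mf : measurable_fun setT f := @measurable_col_mx R k.
pose C l (c : R) := [set x : 'cV[R]_l | `|x| <= c].
have mC l (c : R) : measurable (C l c : set (borel 'cV[R]_l)).
  by apply: closed_borel; exact: closed_normle.
have pmoo c : (pushforward pm f (C (1 + k) c)%N < +oo)%E.
  pose I := `[- c, c]%classic : set R.
  have /le_lt_trans : (pushforward pm f (C (1 + k) c)%N <= pm (I `*` C k c))%E.
    rewrite /pushforward le_measure ?inE//.
    - rewrite -[X in measurable X]setTI; exact: mf.
    - by apply: measurableX; [exact: measurable_itv|exact: mC].
    move=> [t y] /= fc; have c0 : 0 <= c := le_trans (normr_ge0 _) fc.
    split=> /=.
      rewrite /I/= in_itv/= -ler_norml; apply: le_trans fc.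
      have := le_mx_norm (col_mx t%:M y : 'cV[R]_(1 + k)) (lshift k ord0) ord0.
      by rewrite col_mxEu mxE eqxx.
    apply: mx_norm_le => // i j; apply: le_trans fc.
    have := le_mx_norm (col_mx t%:M y : 'cV[R]_(1 + k)) (rshift 1 i) j.
    by rewrite col_mxEd.
  apply; rewrite [ltLHS](_ : _ = lam I * nu (C k c))%E.
    rewrite nuE lte_mul_pinfty ?measure_ge0 ?muoo//.
    by rewrite /lam lebesgue_measure_itv/=; case: ifPn.
  have mI : measurable (I : set (measurableTypeR R)) by exact: measurable_itv.
  exact: (product_measure1E lam nu mI (mC k c)).
unshelve eexists (pushforward pm f : {measure set _ -> \bar R}).
  exact: mf.
split; last exact: pmoo.
by rewrite [LHS]/= muE -nuE.
Qed.

(** * Topology of [Omega_Z], [Psi] and [Psi_L] *)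

Lemma continuous_sum (R : realType) (T : topologicalType) (I : Type)
    (s : seq I) (f : I -> T -> R) :
  (forall i, continuous (f i)) -> continuous (fun x => \sum_(i <- s) f i x).
Proof.
move=> cf; elim: s => [|i s ih].
  by under eq_fun do rewrite big_nil; move=> x; exact: cvg_cst.
by under eq_fun do rewrite big_cons; move=> x; apply: cvgD;
  [exact: cf|exact: ih].
Qed.

Lemma continuous_mulmx (R : realType) (T : topologicalType) (m n p : nat)
    (f : T -> 'M[R]_(m, n)) (g : T -> 'M[R]_(n, p)) :
  continuous f -> continuous g -> continuous (fun x => f x *m g x).
Proof.
move=> cf cg; apply: continuous_mx => i j.
under eq_fun do rewrite mxE.
apply: continuous_sum => k x.
apply: cvgM.
  apply: (@continuous_comp _ _ _ f (fun M : 'M[R]_(m, n) => M i k)).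
    exact: cf.
  exact: coord_continuous.
apply: (@continuous_comp _ _ _ g (fun M : 'M[R]_(n, p) => M k j)).
  exact: cg.
exact: coord_continuous.
Qed.

Lemma continuous_l2norm (R : realType) (k : nat) :
  continuous (@l2norm R k).
Proof.
have cs : continuous (fun x : 'cV[R]_k => \sum_(i < k) x i 0 ^+ 2).
  apply: continuous_sum => i x.
  apply: (@continuous_comp _ _ _ (fun M : 'cV[R]_k => M i 0) (fun t => t ^+ 2)).
    exact: coord_continuous.
  exact: exprn_continuous.
by move=> x; apply: continuous_comp; [exact: cs|exact: sqrt_continuous].
Qed.

Lemma l2norm_coord (R : realType) (k : nat) (x : 'cV[R]_k) i j :
  `|x i j| <= l2norm x.
Proof.
rewrite ord1 -sqrtr_sqr ler_wsqrtr// (bigD1 i)//= lerDl sumr_ge0// => l _.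
exact: sqr_ge0.
Qed.

(** Heine-Borel for row vectors is transported along [vec_mx]: [A] is a closed subset of the
    continuous image of a closed sup-norm ball. *)
Lemma compact_mx (R : realType) (m n : nat) (A : set 'M[R]_(m, n)) (c : R) :
  0 <= c -> closed A -> (forall x, A x -> forall i j, `|x i j| <= c) ->
  compact A.
Proof.
move=> c0 cA Ac.
apply: (@subclosed_compact _ _
  (vec_mx @` [set v : 'rV[R]_(m * n) | `|v| <= c])) => //.
  apply: continuous_compact.
    apply: continuous_subspaceT; apply: continuous_mx => i j.
    by under eq_fun do rewrite mxE; exact: coord_continuous.
  apply: bounded_closed_compact; last exact: closed_normle.
  exists c; split; first exact: num_real.
  by move=> d /ltW cd v /= vc; exact: le_trans cd.
move=> x Ax; exists (mxvec x); last exact: mxvecK.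
apply: mx_norm_le => // i j; rewrite ord1.
by case/mxvec_indexP: j => i' j'; rewrite mxvecE; exact: Ac.
Qed.

Lemma closed_l2ball (R : realType) (k : nat) (r : R) : closed (@l2ball R k r).
Proof.
exact: (iffLR (continuous_closedP _) (@continuous_l2norm R k) _
  (@closed_le _ r)).
Qed.

Lemma compact_l2ball (R : realType) (k : nat) (r : R) : compact (@l2ball R k r).
Proof.
apply: (@compact_mx _ _ _ _ `|r|) => //; first exact: closed_l2ball.
move=> x xr i j; apply: le_trans (ler_norm r).
exact: le_trans (l2norm_coord x i j) xr.
Qed.

(** The diagonal entries of [A^T *m A] are the sums of squares of the columns of [A]. *)
Lemma orthogonal_group_coord (R : realType) (k : nat) (A : 'M[R]_k) i j :
  orthogonal_group A -> `|A i j| <= 1.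
Proof.
move=> /matrixP/(_ j j); rewrite !mxE eqxx/= => Ajj.
rewrite -(@ler_sqr R)// ?nnegrE// expr1n real_normK ?num_real// -[leRHS]Ajj.
rewrite (bigD1 i)//= !mxE -expr2 lerDl sumr_ge0// => l _.
by rewrite !mxE -expr2 sqr_ge0.
Qed.

Lemma closed_preimage (S T : topologicalType) (f : S -> T) (A : set T) :
  continuous f -> closed A -> closed (f @^-1` A).
Proof. by move=> /continuous_closedP; exact. Qed.

Lemma closed_Omega_Z (R : realType) (m : nat) (r : R) :
  closed (@Omega_Z R m r).
Proof.
pose A (p : omegaT R m) : 'M[R]_m.+1 := row_mx p.1.1 p.2.
have c1 : continuous (fun p : omegaT R m => p.1.1).
  by move=> p; apply: (@continuous_comp _ _ _ fst fst); exact: cvg_fst.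
have c2 : continuous (fun p : omegaT R m => p.1.2).
  by move=> p; apply: (@continuous_comp _ _ _ fst snd);
    [exact: cvg_fst|exact: cvg_snd].
have cA : continuous A.
  apply: continuous_mx => i j; rewrite /A.
  rewrite [X in continuous X](_ : _ = fun p : omegaT R m =>
    match fintype.split (j : 'I_(1 + m)) with
    | inl j' => p.1.1 i j' | inr j' => p.2 i j' end).
    case: fintype.split => j' p.
      apply: (@continuous_comp _ _ _ (fun p : omegaT R m => p.1.1)
        (fun M : 'cV[R]_m.+1 => M i j')).
        exact: c1.
      exact: coord_continuous.
    apply: (@continuous_comp _ _ _ snd (fun M : 'M[R]_(m.+1, m) => M i j')).
      exact: cvg_snd.
    exact: coord_continuous.
  by apply/funext => p; rewrite mxE; case: fintype.split.
have cAT : continuous (fun p => (A p)^T).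
  apply: continuous_mx => i j.
  under eq_fun do rewrite mxE.
  move=> p; apply: (@continuous_comp _ _ _ A (fun M : 'M[R]_m.+1 => M j i)).
    exact: cA.
  exact: coord_continuous.
(* The three conditions become preimages of closed sets under continuous maps. *)
rewrite (_ : Omega_Z _ = (fun p => l2norm p.1.1) @^-1` [set 1] `&`
  (fun p => p.1.2) @^-1` `[- r, r] `&`
  (fun p => (A p)^T *m A p) @^-1` [set 1%:M]).
  apply: closedI; first apply: closedI; apply: closed_preimage.
  - move=> p; apply: (@continuous_comp _ _ _ (fun p : omegaT R m => p.1.1)
      (@l2norm R m.+1)).
      exact: c1.
    exact: continuous_l2norm.
  - exact: closed_eq.
  - exact: c2.
  - exact: interval_closed.
  - exact: continuous_mulmx.
  - exact: accessible_closed_set1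
      (hausdorff_accessible (@norm_hausdorff _ _)) _.
apply/seteqP; split=> [[[theta t] Z] [h1 h2 h3]|[[theta t] Z] [[h1 h2] h3]].
  by split=> //; split=> //=; rewrite in_itv.
by split=> //; move: h2; rewrite /= in_itv.
Qed.

Lemma compact_Omega_Z (R : realType) (m : nat) (r : R) :
  compact (@Omega_Z R m r).
Proof.
apply: (@subclosed_compact _ _ (l2ball 1 `*` `[- r, r] `*`
   [set Z : 'M[R]_(m.+1, m) | `|Z| <= 1])).
- exact: closed_Omega_Z.
- apply: compact_setX; last first.
    apply: (@compact_mx _ _ _ _ 1) => //; first exact: closed_normle.
    by move=> x x1 i j; exact: le_trans (le_mx_norm x i j) x1.
  by apply: compact_setX; [exact: compact_l2ball|exact: segment_compact].
move=> [[theta t] Z] [theta1 tr oZ]; split=> [/=|/=].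
  by split=> /=; [rewrite /l2ball/= theta1|rewrite in_itv].
apply: mx_norm_le => // i j.
have := orthogonal_group_coord i (rshift 1 j) oZ.
by rewrite (@row_mxEr _ _ 1).
Qed.

(** Over [Omega_Z], the columns of Z form an orthonormal basis of the complement of theta, so this
    is the point with coordinates y in the hyperplane of normal theta and offset t. *)
Definition plane_point (R : realType) (m : nat) (q : psiT R m) : 'cV[R]_m.+1 :=
  q.1.1.2 *: q.1.1.1 + q.1.2 *m q.2.

Lemma Psi_LE (R : realType) (m : nat) (r : R) (L : set 'cV[R]_m.+1) :
  Psi_L r L = Psi r `&` @plane_point R m @^-1` L.
Proof. by apply/seteqP; split=> -[[[theta t] Z] y]. Qed.

Lemma continuous_plane_point (R : realType) (m : nat) :
  continuous (@plane_point R m).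
Proof.
have c1 : continuous (fun q : psiT R m => q.1.1).
  by move=> q; apply: (@continuous_comp _ _ _ fst fst); exact: cvg_fst.
have cZ : continuous (fun q : psiT R m => q.1.2).
  by move=> q; apply: (@continuous_comp _ _ _ fst snd);
    [exact: cvg_fst|exact: cvg_snd].
move=> q; apply: cvgD.
  apply: cvgZ.
    apply: (@continuous_comp _ _ _ (fun q : psiT R m => q.1.1) snd).
      exact: c1.
    exact: cvg_snd.
  apply: (@continuous_comp _ _ _ (fun q : psiT R m => q.1.1) fst).
    exact: c1.
  exact: cvg_fst.
apply: (@continuous_mulmx _ _ _ _ _ (fun q : psiT R m => q.1.2) snd) => //.
by move=> x; exact: cvg_snd.
Qed.

Lemma closed_Psi (R : realType) (m : nat) (r : R) : closed (@Psi R m r).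
Proof.
rewrite (_ : Psi r = fst @^-1` Omega_Z r `&` snd @^-1` l2ball r)//.
apply: closedI; apply: closed_preimage.
- by move=> x; exact: cvg_fst.
- exact: closed_Omega_Z.
- by move=> x; exact: cvg_snd.
- exact: closed_l2ball.
Qed.

Lemma closed_Psi_L (R : realType) (m : nat) (r : R) (L : set 'cV[R]_m.+1) :
  closed L -> closed (Psi_L r L).
Proof.
move=> cL; rewrite Psi_LE; apply: closedI; first exact: closed_Psi.
exact: closed_preimage (@continuous_plane_point R m) cL.
Qed.

(** * Functions peaking exactly on a closed set *)

Lemma closed_peak_function (R : realType) (V : normedModType R) (L : set V) :
  closed L -> exists u : V -> R, [/\ continuous u, forall v, 0 < u v <= 1 &
    forall v, u v = 1 <-> L v].
Proof.
move=> cL; suff [g [cg g0 gL]] : exists g : V -> R, [/\ continuous g,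
    forall v, 0 <= g v & forall v, g v = 0 <-> L v].
  (* For nonempty [L], [g] will be the distance to [L]; its zeros become the points where [u] is
     1. *)
  exists (fun v => (1 + g v)^-1); split=> [v|v|v].
  - apply: cvgV; first by rewrite gt_eqF// ltr_pwDl.
    by apply: cvgD; [exact: cvg_cst|exact: cg].
  - by rewrite invr_gt0 ltr_pwDl//= invf_le1 ?ltr_pwDl// lerDl.
  - rewrite -gL; split=> [/(congr1 GRing.inv)|->]; last by rewrite addr0 invr1.
    rewrite invrK invr1 => /eqP.
    by rewrite -subr_eq0 addrAC subrr add0r => /eqP.
(* The distance to the empty set is +oo, which [fine] would send to 0; a nonzero constant replaces
   it. *)
have [L0|/set0P[a La]] := eqVneq L set0.
  exists (fun=> 1); split=> [v|//|v]; first exact: cvg_cst.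
  by rewrite L0; split=> // /eqP; rewrite oner_eq0.
have fin v : edist_inf L v \is a fin_num.
  rewrite ge0_fin_numE ?edist_inf_ge0//.
  apply: (@le_lt_trans _ _ (edist (v, a))).
    by apply: ereal_inf_lbound; exists a.
  rewrite -ge0_fin_numE//; apply/edist_finP; exists (`|v - a| + 1) => /=.
    by rewrite ltr_pwDr.
  by rewrite -ball_normE/= ltrDl.
exists (fun v => fine (edist_inf L v)); split=> [v|v|v].
- by apply: fine_cvg; rewrite fineK//; exact: edist_inf_continuous.
- by rewrite fine_ge0// edist_inf_ge0.
split=> [dv0|Lv]; last by rewrite edist_inf0.
(* At distance zero from [L], every ball around [v] meets [L], so [v] is in the closure of [L]. *)
rewrite (iffLR (closure_id _) cL) => B /nbhs_ballP[e /= e0 eB].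
have : (edist_inf L v < e%:E)%E by rewrite -(fineK (fin v)) dv0 lte_fin.
move=> /ereal_inf_lt[_ [b Lb <-] /edist_lt_ball/= vb].
by exists b; split=> //; exact: eB.
Qed.

(** * Integration over the ball *)

Lemma sigma_finite_ltoo d (T : measurableType d) (R : realType)
    (mu : {measure set T -> \bar R}) :
  (mu setT < +oo)%E -> sigma_finite setT mu.
Proof. by move=> muoo; exists (fun=> setT); rewrite ?bigcup_const. Qed.

Lemma measurable_l2ball (R : realType) (k : nat) (r : R) :
  measurable (@l2ball R k r : set (borel 'cV[R]_k)).
Proof. by apply: closed_borel; exact: closed_l2ball. Qed.

Lemma lebesgue_cV_l2ball_ltoo (R : realType) (k : nat) (r : R) :
  (@lebesgue_cV R k (l2ball r) < +oo)%E.
Proof.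
have [lam [-> lamoo]] := lebesgue_cV_sigma_finite R k.
apply: le_lt_trans (lamoo `|r|); apply: le_measure; rewrite ?inE.
- exact: measurable_l2ball.
- by apply: closed_borel; exact: closed_normle.
move=> x xr; apply: mx_norm_le => // i j.
by rewrite (le_trans (l2norm_coord x i j))// (le_trans xr)// ler_norm.
Qed.

(** Turns [lebesgue_ball] into a measure on the whole space, fit for products. The last clause
    returns to the integrals in [Lambda]: the complement of the ball is null, and on subsets of the
    ball both measures agree. *)
Lemma lebesgue_ball_sigma_finite (R : realType) (k : nat) (r : R) :
  exists mu : {sigma_finite_measure set (borel 'cV[R]_k) -> \bar R},
    [/\ (mu : set _ -> \bar R) = @lebesgue_ball R k r,
      mu (~` l2ball r) = 0%E &
      forall f : borel 'cV[R]_k -> \bar R,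
        measurable_fun [set: borel 'cV[R]_k] f ->
        (forall y, 0 <= f y)%E ->
        (\int[mu]_y f y = \int[@lebesgue_cV R k]_(y in l2ball r) f y)%E].
Proof.
have [lam [lamE _]] := lebesgue_cV_sigma_finite R k.
have mB := @measurable_l2ball R k r.
pose nu : {measure set (borel 'cV[R]_k) -> \bar R} := mrestr lam mB.
have nuoo : (nu setT < +oo)%E.
  by rewrite /nu/= /mrestr setTI -lamE lebesgue_cV_l2ball_ltoo.
have [mu muE] := sigma_finite_measureP (sigma_finite_ltoo nuoo).
have nuC : nu (~` l2ball r) = 0%E by rewrite /nu/= /mrestr setICl measure0.
exists mu; rewrite muE; split=> //; first by rewrite /lebesgue_ball lamE.
move=> f mf f0; rewrite lamE.
rewrite (ge0_negligible_integral (measurableC mB) measurableT mf _ nuC)//.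
rewrite setTD setCK; apply: eq_measure_integral => A mA AB.
by rewrite /nu/= /mrestr setIidl.
Qed.

(** Admissible [w] are continuous only relative to [Psi r]. Relatively open sets are traces of open
    sets on a Borel set, so the extension by zero is Borel. *)
Lemma within_continuous_borel (R : realType) (T : ptopologicalType)
    (D : set T) (f : T -> R) :
  closed D -> {within D, continuous f} ->
  measurable_fun setT (f \_ D : borel T -> R).
Proof.
move=> cD /continuousP cf; have mD := closed_borel cD.
apply: (iffLR (@measurable_restrictT _ _ (borel T) R D f mD)).
apply: (measurability _ (RGenOpens.measurableE R)).
move=> _ [_ [a [b ->] <-]].
have /cf/open_subspaceP[V oV VD] : open (`]a, b[%classic : set R).
  exact: interval_open.
rewrite setIC -VD; apply: measurableI => //.
exact: sub_sigma_algebra.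
Qed.

(** * Weak duality *)

Lemma measure_feasible_le (R : realType) (m : nat) (r : R)
    (L : set 'cV[R]_m.+1) (gamma : R) (w : psiT R m -> R)
    (mu0 : {measure set (borel (omegaT R m)) -> \bar R})
    (mu muhat : {measure set (borel (psiT R m)) -> \bar R}) :
  closed L -> function_feasible r L gamma w ->
  measure_feasible r L mu0 mu muhat -> (mu (Psi_L r L) <= gamma%:E)%E.
Proof.
move=> cL [cw wgamma w1 w0] [mu0C muC muhatC mu0E mu01].
have mO : measurable (Omega_Z r : set (borel (omegaT R m))).
  by apply: closed_borel; exact: closed_Omega_Z.
have [nu0 nu0E] : exists nu :
    {sigma_finite_measure set (borel (omegaT R m)) -> \bar R},
    (nu : set _ -> \bar R) = mu0.
  apply/sigma_finite_measureP/sigma_finite_ltoo.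
  suff -> : mu0 setT = (mu0 (Omega_Z r) + mu0 (~` Omega_Z r))%E.
    by rewrite mu01 [X in (_ + X)%E]mu0C adde0 ltry.
  by rewrite -measureU ?setICr ?setUv//; exact: measurableC.
have [lam [lamE _ lamI]] := lebesgue_ball_sigma_finite m r.
(* [\_] extends by [point], which is 0 in R. *)
pose W := w \_ (Psi r).
have W0 q : 0 <= W q.
  by rewrite /W patchE; case: ifPn => // /set_mem; exact: w0.
have mW : measurable_fun setT (W : borel (psiT R m) -> R).
  by apply: within_continuous_borel => //; exact: closed_Psi.
(* The identity from the product sigma-algebra to the Borel one. Pushing forward along it lets the
   product measure be compared with [mu] and [muhat]. *)
pose pid (q : borel (omegaT R m) * borel 'cV[R]_m) : borel (psiT R m) := q.
have mpid : measurable_fun setT pid.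
  move=> _ A mA; rewrite setTI.
  exact: (borel_measurable_prod (@mx_second_countable R m 1)).
pose E q := (W q)%:E.
have mE : measurable_fun setT (E : borel (psiT R m) -> \bar R).
  exact/measurable_EFinP.
have mEp : measurable_fun setT (E \o pid) by exact: measurableT_comp mE mpid.
have mPL : measurable (Psi_L r L : set (borel (psiT R m))).
  by apply: closed_borel; exact: closed_Psi_L.
have -> : mu (Psi_L r L) = (\int[mu]_q (\1_(Psi_L r L) q)%:E)%E.
  by rewrite integral_indic// setIT.
(* [W] dominates the indicator of [Psi_L], and its integral against [muhat] is nonnegative. *)
apply: (@le_trans _ _ (\int[measure_add mu muhat]_q E q)%E).
  rewrite (ge0_integral_measure_add mu muhat measurableT _ mE);
    last by move=> q _; rewrite lee_fin.
  rewrite -[leLHS]adde0; apply: leeD;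
    last by apply: integral_ge0 => q _; rewrite lee_fin.
  apply: ge0_le_integral => //.
  - by apply/measurable_EFinP; exact: measurable_indic.
  - move=> q _; rewrite lee_fin indicE.
    case: (boolP (q \in _)) => [/set_mem qL|_]; last exact: W0.
    by rewrite /W patchE mem_set ?w1//; case: qL.
have -> : (\int[measure_add mu muhat]_q E q =
           \int[pushforward (nu0 \x lam)%E pid]_q E q)%E.
  apply: eq_measure_integral => A mA _.
  by rewrite [LHS]measure_addE -mu0E// -nu0E -lamE.
rewrite ge0_integral_pushforward//; last by move=> q _; rewrite lee_fin.
have E0 q : (0 <= (E \o pid) q)%E by rewrite lee_fin.
rewrite preimage_setT (fubini_tonelli1 _ mEp E0).
have FE p : fubini_F lam (E \o pid) p =
    (\int[@lebesgue_cV R m]_(y in l2ball r) E (p, y))%E.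
  apply: lamI => [|y]; last exact: E0.
  exact: measurableT_comp mEp (pair1_measurable _).
have F0 p : (0 <= fubini_F lam (E \o pid) p)%E by exact: integral_ge0.
have mF : measurable_fun setT (fubini_F lam (E \o pid)).
  exact: measurable_fun_fubini_tonelli_F.
have FO p : Omega_Z r p -> (fubini_F lam (E \o pid) p <= gamma%:E)%E.
  move=> Op; rewrite FE; apply: le_trans (wgamma p Op).
  rewrite le_eqVlt; apply/orP; left; apply/eqP; rewrite /Lambda.
  have [lc [-> _]] := lebesgue_cV_sigma_finite R m.
  apply: eq_integral => y /set_mem yB.
  by rewrite /E /W patchE mem_set.
(* The bound [FO] holds only on [Omega_Z], whose complement is null for [mu0]. *)
rewrite nu0E.
rewrite (ge0_negligible_integral (measurableC mO) measurableT mF _ mu0C)//.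
rewrite setTD setCK.
(* Since [mu0] has mass 1 on [Omega_Z], some point exists there, and [gamma] bounds a nonnegative
   integral at it. *)
have gamma0 : (0 <= gamma%:E)%E.
  have [e|/set0P[p Op]] := eqVneq (@Omega_Z R m r) set0; last first.
    exact: le_trans (F0 p) (FO p Op).
  by move: mu01; rewrite e measure0 => /esym/eqP; rewrite onee_eq0.
apply: (@le_trans _ _ (\int[mu0]_(p in Omega_Z r) cst gamma%:E p)%E).
  by apply: ge0_le_integral => //; exact: measurable_funS mF.
by rewrite integral_cst// [X in (_ * X)%E]mu01 mule1.
Qed.

(** * Lower bound for [m_star] from Dirac masses *)

Lemma continuous_pair (S T U : topologicalType) (f : S -> T) (g : S -> U) :
  continuous f -> continuous g -> continuous (fun x => (f x, g x)).
Proof. by move=> cf cg x; exact: (cvg_pair (cf x) (cg x)). Qed.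

Lemma continuous_pair1 (T U : topologicalType) (p : T) :
  continuous (fun y : U => (p, y)).
Proof.
by apply: continuous_pair => y; [exact: cvg_cst|exact: cvg_id].
Qed.

Lemma section_le_m_star (R : realType) (m : nat) (r : R)
    (L : set 'cV[R]_m.+1) (p : omegaT R m) :
  closed L -> Omega_Z r p ->
  (lebesgue_ball r [set y | Psi_L r L (p, y)] <= m_star r L)%E.
Proof.
move=> cL Op.
have [lam [lamE lamC _]] := lebesgue_ball_sigma_finite m r.
pose j (y : borel 'cV[R]_m) : borel (psiT R m) := (p, y).
have mj : measurable_fun setT j.
  exact: (@continuous_borel 'cV[R]_m (psiT R m) _ (@continuous_pair1 _ _ p)).
(* [nu] is the product of the Dirac mass at [p] with [lam], realized directly on the Borel
   sigma-algebra of [psiT]. *)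
have [nu nuE] : exists nu : {measure set (borel (psiT R m)) -> \bar R},
    (nu : set _ -> \bar R) = pushforward lam j.
  by unshelve eexists (pushforward lam j : {measure set _ -> \bar R}).
have mPL : measurable (Psi_L r L : set (borel (psiT R m))).
  by apply: closed_borel; exact: closed_Psi_L.
apply: ereal_sup_ubound => /=.
exists (@dirac _ (borel (omegaT R m)) p R), (mrestr nu mPL),
  (mrestr nu (measurableC mPL)).
split; last by rewrite /= /mrestr setIid nuE /pushforward lamE.
split.
- by rewrite /borel_measures_on/= diracE memNset.
- by rewrite /borel_measures_on/= /mrestr setICl measure0.
- rewrite /borel_measures_on/= /mrestr nuE /pushforward.
  (* As [p] is in [Omega_Z], the point (p, y) leaves [Psi] only when y leaves the ball, which is a
     null event for [lam]. *)
  apply: (subset_measure0 _ _ _ lamC).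
  + rewrite -[X in measurable X]setTI; apply: mj => //.
    by apply: measurableI; apply: measurableC => //;
      apply: closed_borel; exact: closed_Psi.
  + by apply: measurableC; exact: measurable_l2ball.
  move=> y [/= nP _] yB; apply: nP; split=> //.
- move=> A mA.
  have mA' := borel_measurable_prod (@mx_second_countable R m 1) mA.
  (* The product measure integrates the measures of sections; the Dirac mass keeps the section at
     [p], whose measure is [nu A]. *)
  rewrite -lamE /product_measure1 integral_dirac//=; last first.
    exact: measurable_fun_xsection.
  rewrite diracT mul1e.
  transitivity (nu A).
    by rewrite nuE/= /pushforward xsectionE.
  by rewrite /= /mrestr -setDE addeC (measureDI nu mA mPL).
- by rewrite /= diracE mem_set.
Qed.

(** * Upper bound for [p_star] *)

Lemma section_near_le (X Y : topologicalType) (R : realType) (D : set Y)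
    (w : X * Y -> R) (p : X) (e : R) :
  compact D -> continuous w -> 0 < e ->
  \forall p' \near p, forall y, D y -> w (p', y) <= w (p, y) + e.
Proof.
move=> cD cw e0.
(* Tube lemma: it suffices to find, for each y in [D], a product neighborhood of (y, p) where the
   inequality holds. *)
apply: ((iffLR (compact_near_coveringP D) cD) X (nbhs p)
  (fun p' y => w (p', y) <= w (p, y) + e) _) => y Dy.
pose K (z : Y * X) := w (z.2, z.1) - w (p, z.1).
have cK : continuous K.
  move=> z; apply: cvgB.
    apply: (@continuous_comp _ _ _ (fun z : Y * X => (z.2, z.1)) w);
      last exact: cw.
    by apply: continuous_pair => z'; [exact: cvg_snd|exact: cvg_fst].
  apply: (@continuous_comp _ _ _ (fun z : Y * X => (p, z.1)) w); last exact: cw.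
  by apply: continuous_pair => z'; [exact: cvg_cst|exact: cvg_fst].
have K0 : K (y, p) < e by rewrite /K/= subrr.
have [[U V] /= [Uy Vp] UV] := cvgr_lt _ (cK (y, p)) _ K0.
by exists (U, V) => //= -[y' p'] /UV; rewrite /K/= ltrBlDl => /ltW.
Qed.

Lemma p_star_le (R : realType) (m : nat) (r : R) (L : set 'cV[R]_m.+1)
    (c : R) :
  closed L ->
  (forall p, Omega_Z r p ->
    lebesgue_ball r [set y | Psi_L r L (p, y)] < c%:E)%E ->
  (p_star r L <= c%:E)%E.
Proof.
move=> cL Lc.
have [u [cu u01 uL]] := closed_peak_function cL.
have [lam [lamE lamoo]] := lebesgue_cV_sigma_finite R m.
have mD := @measurable_l2ball R m r.
pose pt := @plane_point R m.
pose w k (q : psiT R m) := u (pt q) ^+ k.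
have w0 k q : 0 <= w k q by rewrite exprn_ge0// ltW//; case/andP: (u01 (pt q)).
have w1 k q : w k q <= 1.
  by rewrite exprn_ile1//; case/andP: (u01 (pt q)) => // /ltW.
have cw k : continuous (w k).
  have cupt : continuous (u \o pt).
    by move=> q; apply: continuous_comp;
      [exact: continuous_plane_point|exact: cu].
  move=> q; apply: (@continuous_comp _ _ _ (u \o pt) (fun t => t ^+ k)).
    exact: cupt.
  exact: exprn_continuous.
have mw k p : measurable_fun (l2ball r : set (borel 'cV[R]_m))
    (fun y : borel 'cV[R]_m => (w k (p, y))%:E).
  apply/measurable_EFinP/measurable_funTS.
  apply: (@continuous_borel_real R 'cV[R]_m (fun y => w k (p, y))) => y.
  apply: (@continuous_comp _ _ _ (fun y : 'cV[R]_m => (p, y)) (w k));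
    last exact: cw.
  exact: continuous_pair1.
have wnat k l p : (k <= l)%N -> (Lambda r (w l) p <= Lambda r (w k) p)%E.
  move=> kl; rewrite /Lambda lamE; apply: ge0_le_integral => //.
  - by move=> y _; rewrite lee_fin.
  - move=> y _; rewrite lee_fin ler_wiXn2l//;
      by case/andP: (u01 (pt (p, y))) => // /ltW.
have lamD : (lam (l2ball r) < +oo)%E.
  by rewrite -lamE lebesgue_cV_l2ball_ltoo.
(* Upper semicontinuity of [Lambda r (w k)], in the form of an open condition at the level c. *)
have near_p k p : (Lambda r (w k) p < c%:E)%E ->
    \forall p' \near p, (Lambda r (w k) p' < c%:E)%E.
  rewrite /Lambda lamE => Lpc.
  have Lp0 : (0 <= \int[lam]_(y in l2ball r) (w k (p, y))%:E)%E.
    by apply: integral_ge0 => y _; rewrite lee_fin.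
  have Lpfin : (\int[lam]_(y in l2ball r) (w k (p, y))%:E)%E \is a fin_num.
    by rewrite ge0_fin_numE// (lt_trans Lpc)// ltry.
  have lamfin : lam (l2ball r) \is a fin_num by rewrite ge0_fin_numE.
  pose V := fine (lam (l2ball r)).
  pose I := fine (\int[lam]_(y in l2ball r) (w k (p, y))%:E)%E.
  have V0 : 0 <= V by rewrite fine_ge0.
  have Ic : I < c by rewrite -lte_fin fineK.
  (* Raising the integrand by this amount adds (c - I) V / (V + 1) to the integral, which is less
     than c - I. The added 1 also covers V = 0. *)
  have e0 : 0 < (c - I) / (V + 1) by rewrite divr_gt0 ?subr_gt0// ltr_wpDl.
  have := @section_near_le _ _ _ (l2ball r) (w k) p _
    (@compact_l2ball R m r) (cw k) e0.
  apply: filterS => p' p'e.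
  apply: (@le_lt_trans _ _ (\int[lam]_(y in l2ball r)
      ((w k (p, y))%:E + (cst ((c - I) / (V + 1))%:E) y)))%E.
    apply: ge0_le_integral => //.
    - by move=> y _; rewrite lee_fin.
    - by apply: emeasurable_funD => //; exact: mw.
  have e0' (y : borel 'cV[R]_m) : l2ball r y ->
      (0 <= cst ((c - I) / (V + 1))%:E y)%E by rewrite lee_fin ltW.
  have w0' y : l2ball r y -> (0 <= (w k (p, y))%:E)%E by rewrite lee_fin.
  have me : measurable_fun (l2ball r : set (borel 'cV[R]_m))
    (cst ((c - I) / (V + 1))%:E) by exact: measurable_cst.
  rewrite (ge0_integralD lam mD w0' (mw k p) e0' me).
  have lamV : lam (l2ball r) = V%:E by rewrite fineK.
  rewrite integral_cst// [X in (_ * X)%E]lamV -(fineK Lpfin).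
  rewrite -EFinM -EFinD lte_fin.
  rewrite -/I -ltrBrDl mulrAC ltr_pdivrMr ?ltr_wpDl//.
  by rewrite ltr_pM2l ?subr_gt0// ltrDl.
have cvg_p p : Omega_Z r p -> exists k, (Lambda r (w k) p < c%:E)%E.
  move=> Op; pose S := [set y | L (pt (p, y))].
  have mS : measurable (S : set (borel 'cV[R]_m)).
    apply: closed_borel;
    apply: (@closed_preimage _ _ (fun y => pt (p, y))) => //.
    move=> y; apply: (@continuous_comp _ _ _ (fun y : 'cV[R]_m => (p, y)) pt).
      exact: continuous_pair1.
    exact: continuous_plane_point.
  (* On [S] the powers are constantly 1; elsewhere [u] is below 1 and they tend to 0. The constant 1
     dominates and is integrable on the ball. *)
  have [|||||_ _] := @dominated_convergence _ _ _ lam _ mD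
    (fun k y => (w k (p, y))%:E) (fun y => (\1_S y)%:E) (cst 1%E).
  - by move=> k; exact: mw.
  - by apply/measurable_EFinP; exact: measurable_indic.
  - apply: aeW => y _; apply/fine_cvgP; split; first exact: nearW.
    rewrite /comp/= indicE; case: (boolP (y \in S)) => [/set_mem yS|yS].
      rewrite /w (iffRL (uL _) yS); under eq_fun do rewrite expr1n.
      exact: cvg_cst.
    have [u0 u1] := andP (u01 (pt (p, y))).
    apply: cvg_expr; rewrite gtr0_norm// lt_neqAle u1 andbT.
    by apply: contra yS => /eqP /uL /mem_set.
  - apply/integrableP; split; first exact: measurable_cst.
    rewrite [ltLHS](_ : _ = lam (l2ball r))// -[RHS]mul1e -integral_cst//.
    by apply: eq_integral => y _; rewrite abse1.
  - by apply: aeW => y k _; rewrite gee0_abs ?lee_fin.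
  rewrite integral_indic// => cvgL.
  have SL : (lam (S `&` l2ball r) < c%:E)%E.
    rewrite -lamE; apply: le_lt_trans (Lc p Op); rewrite /lebesgue_ball.
    rewrite le_eqVlt; apply/orP; left; apply/eqP; congr (lebesgue_cV _).
    by rewrite Psi_LE; apply/seteqP; split=> [y [Ly yD]|y [[_ Ly] yD]].
  have /filter_ex[k kc] : \forall k \near \oo,
      (\int[lam]_(y in l2ball r) (w k (p, y))%:E < c%:E)%E.
    exact: (cvgL _ (open_nbhs_nbhs (conj (@open_ereal_lt_ereal _ c%:E) SL))).
  by exists k; rewrite /Lambda lamE.
(* Compactness makes the threshold on k uniform in p: [near_p] spreads the bound to nearby points,
   and [wnat] to all larger exponents. *)
have : \forall k \near \oo, @Omega_Z R m r `<=`
    (fun p => Lambda r (w k) p <= c%:E)%E.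
  apply: (iffLR (compact_near_coveringP _) (@compact_Omega_Z R m r)) => p Op.
  have [k kc] := cvg_p p Op.
  exists ([set p' | (Lambda r (w k) p' < c%:E)%E], [set l | (k <= l)%N]) => /=.
    by split; [exact: near_p|exact: nbhs_infty_ge].
  by move=> [p' l] /= [/ltW p'c kl]; apply: le_trans p'c; exact: wnat.
move=> [k _ /(_ k (leqnn k)) kc].
apply: ereal_inf_lbound => /=; exists c => //; exists (w k); split=> //.
- by apply: continuous_subspaceT; exact: cw.
- by rewrite Psi_LE => q [_ /uL uq]; rewrite /w uq expr1n.
Qed.

(** * Strong duality *)

Theorem theorem3p5 (R : realType) (m : nat) (r : R) (L : set 'cV[R]_m.+1) :
  0 < r -> compact L -> L `<=` l2ball r ->
  p_star r L = m_star r L.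
Proof.
move=> _ cL _.
have {}cL : closed L.
  by apply: compact_closed => //; exact: norm_hausdorff.
apply/le_anti/andP; split; last first.
  apply: ge_ereal_sup => _ [mu0 [mu [muhat [mfeas ->]]]].
  apply: le_ereal_inf_tmp => _ [gamma [w wfeas] <-].
  exact: measure_feasible_le cL wfeas mfeas.
(* A real c strictly above [m_star] leaves the strict gap that [p_star_le] requires at every
   section. *)
have le_c (c : R) : (m_star r L < c%:E)%E -> (p_star r L <= c%:E)%E.
  move=> mc; apply: p_star_le => // p Op.
  exact: le_lt_trans (section_le_m_star cL Op) mc.
(* If [m_star] were -oo, every real would bound [p_star]; for a finite value, c exceeds it by an
   arbitrary e > 0. *)
case: (m_star r L) le_c => [s||] le_c; last 1 first.
- by rewrite (@eq_ninfty _ (p_star r L)) => // c; apply: le_c; rewrite ltNyr.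
- by apply/lee_addgt0Pr => e e0; apply: le_c; rewrite lte_fin ltrDl.
- exact: leey.
Qed.
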